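(* Let $k>1$ and $N>1$ be integers, and let $f\in S_{2k}(\Gamma_0(N))$ be a normalized cuspidal eigenform of weight $2k$ and level $N$ with coefficients in the ring of integers $\mathcal{O}_K$ of a number field $K$. Let $M_f\ge 1$ be a natural number such that for every prime $p\nmid M_f$, either $a_f(p)=0$ or $a_f(p^r)\neq 0$ for all $r\ge 1$, and put $N_f:=\mathrm{lcm}(N,M_f)$. Let $E$ be an elliptic curve over $\mathbb{Q}$ of conductor $N_E$ which has a cyclic rational $4$-isogeny, and let $f_E$ be the weight $2$ cuspidal eigenform of level $N_E$ corresponding to $E$. If $f$ and $f_E$ are $2$-adically close, then $$ i_f(n)\ll n^{1/4} $$ for all $n\gg 0$, where the implied constant depends only on $N_fN_E$. That is, there is a constant $C>0$ depending only on $N_fN_E$ such that $i_f(n)\le C n^{1/4}$ for all sufficiently large integers $n$.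
   Context: For a cusp form $f(z)=\sum_{n\ge 1} a_f(n)q^n$ and $n\in\mathbb{N}$, define $i_f(n) := \max\{ i : a_f(n+j)=0 \text{ for all } 0\le j\le i\}$ (with $i_f(n)=0$ if $a_f(n)\neq 0$). An elliptic curve $E/\mathbb{Q}$ has a cyclic rational $4$-isogeny if there is an isogeny $\varphi:E\to E'$ of elliptic curves defined over $\mathbb{Q}$ with $\ker(\varphi)(\overline{\mathbb{Q}})\cong \mathbb{Z}/4\mathbb{Z}$. For an elliptic curve $E/\mathbb{Q}$ of conductor $N_E$, $f_E$ denotes the normalized cuspidal eigenform of weight $2$ and level $N_E$ with rational (integer) Fourier coefficients corresponding to $E$ by the modularity theorem. A natural number $M_f$ with the stated property exists for every normalized cuspidal eigenform $f$ (Kowalski–Robert–Wu). Define $\alpha:\mathbb{Z}\to\mathbb{Z}$ by $\alpha(n)=0$ if $n\le 1$, $\alpha(2)=1$, and $\alpha(n)=n-2$ if $n>2$. Definition ($2$-adically close). Let $k_1,k_2$ be positive integers such that $2k_1\equiv 2k_2\pmod{2^s}$ for some integer $s\ge 1$. For $i=1,2$, let $f_i$ be a cuspidal eigenform on $\Gamma_0(N_i)$ of level $N_i$ and weight $2k_i$ with coefficients in $\mathcal{O}_K$. Then $f_1$ and $f_2$ are $2$-adically close if there exist a prime ideal $\mathfrak{q}$ of $\mathcal{O}_K$ over $2$, with ramification index $e(\mathfrak{q}/2)$, and an integer $m$ with $s\ge \alpha\left(\lceil m/e(\mathfrak{q}/2)\rceil\right)\ge 1$ such that $a_{f_1}(p)\equiv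 a_{f_2}(p)\pmod{\mathfrak{q}^m}$ for all primes $p\nmid 2N_1N_2$. *)

(* Defs.v *)
From HB Require Import structures.
From mathcomp Require Import all_boot all_order all_fingroup all_algebra all_field.
From mathcomp Require mpoly.
Import (canonicals, coercions) mpoly.
From mathcomp Require Import complex.
From mathcomp Require Import all_classical all_reals all_analysis.

Set Implicit Arguments.
Unset Strict Implicit.
Unset Printing Implicit Defensive.

Import Order.TTheory GRing.Theory Num.Theory.
Import numFieldNormedType.Exports.
Local Open Scope classical_set_scope.
Local Open Scope ring_scope.

(* A modular form is a function on all of R[i] of which only the values on the
   upper half plane matter. *)

Section ModularForms.
Variable R : realType.
Local Notation C := (complex R).
Implicit Types (f : C -> C) (a : nat -> C) (z : C) (g : 'M[int]_2).

Definition upper_half_plane : set C := [set z | 0 < complex.Im z].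

(* e^{2 pi i z / h} *)
Definition qparam (h : nat) (z : C) : C :=
  let x := complex.Re z in let y := complex.Im z in
  let t := 2 * pi / h%:R : R in
  Complex (expR (- (t * y)) * cos (t * x)) (expR (- (t * y)) * sin (t * x)).

Definition holomorphic_on_uhp f : Prop :=
  forall z, upper_half_plane z -> derivable (f : C^o -> C^o) z 1.

Definition moebius_num g z : C := (g ord0 ord0)%:~R * z + (g ord0 ord_max)%:~R.
Definition moebius_den g z : C :=
  (g ord_max ord0)%:~R * z + (g ord_max ord_max)%:~R.

Definition slash (w : nat) f g : C -> C := fun z =>
  moebius_den g z ^- w * f (moebius_num g z / moebius_den g z).

Definition SL2Z : set 'M[int]_2 := [set g | \det g = 1].
Definition Gamma0 (N : nat) : set 'M[int]_2 :=
  [set g | \det g = 1 /\ (N%:Z %| g ord_max ord0)%Z].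

Definition has_q_expansion (h : nat) f a : Prop :=
  forall z, upper_half_plane z ->
    series (fun n => a n * qparam h z ^+ n : C^o) @ \oo --> (f z : C^o).

(* Gamma(N) is contained in Gamma_0(N), so every slash translate is
   N-periodic; vanishing of its constant term is cuspidality at the
   corresponding cusp. *)
Definition cusp_form (w N : nat) f : Prop :=
  [/\ holomorphic_on_uhp f,
      forall g, Gamma0 N g ->
        forall z, upper_half_plane z -> slash w f g z = f z
    & forall g, SL2Z g ->
        exists2 a, a 0%N = 0 & has_q_expansion N (slash w f g) a].

(* n-th Fourier coefficient of T_m applied to a form with Fourier
   coefficients [a], of weight w and level N (trivial character). At primes
   dividing N this is the operator U_p. *)
Definition hecke (w N m : nat) a (n : nat) : C :=
  \sum_(d <- divisors (gcdn m n) | coprime d N)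
     d%:R ^+ w.-1 * a ((m * n) %/ d ^ 2)%N.

Definition cuspidal_eigenform (w N : nat) f a : Prop :=
  [/\ cusp_form w N f, has_q_expansion 1 f a, exists n, a n != 0
    & forall m, (0 < m)%N ->
        exists lambda, forall n, hecke w N m a n = lambda * a n].

Definition normalized_cuspidal_eigenform (w N : nat) f a : Prop :=
  cuspidal_eigenform w N f a /\ a 1%N = 1.

End ModularForms.

Section Ideals.
Variable K : fieldExtType rat.
Implicit Types (I J P : set K).

Definition integers : set K := [set x | integralOver (intr : int -> K) x].

Definition ideal I : Prop :=
  [/\ I `<=` integers, I 0, forall x y, I x -> I y -> I (x + y)
    & forall x y, integers x -> I y -> I (x * y)].

Definition prime_ideal P : Prop :=
  [/\ ideal P, ~ P 1
    & forall x y, integers x -> integers y -> P (x * y) -> P x \/ P y].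

Definition prime_over (p : nat) P : Prop := prime_ideal P /\ P p%:R.

Definition ideal_mul I J : set K :=
  [set x | exists2 s : seq (K * K),
     (forall u, u \in s -> I u.1 /\ J u.2) & x = \sum_(u <- s) u.1 * u.2].

Definition ideal_exp I (n : nat) : set K := iter n (ideal_mul I) integers.

Definition principal (x : K) : set K := [set x * y | y in integers].

(* e is the exponent of P in the factorization of (p). *)
Definition ramification_index (p : nat) P (e : nat) : Prop :=
  exists J, [/\ ideal J, ~ (J `<=` P)
              & principal p%:R = ideal_mul (ideal_exp P e) J].

End Ideals.

Definition alpha (n : int) : int :=
  if n <= 1 then 0 else if n == 2 then 1 else n - 2.

(* a1, a2 are the coefficient sequences of forms of weights 2 k1, 2 k2 and
   levels N1, N2. A negative m would have alpha(...) = 0, so m is a nat. *)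
Definition two_adically_close (K : fieldExtType rat)
    (k1 N1 : nat) (a1 : nat -> K) (k2 N2 : nat) (a2 : nat -> K) : Prop :=
  exists s : nat, [/\ (1 <= s)%N, 2 * k1 = 2 * k2 %[mod 2 ^ s]
    & exists (q : set K) (e m : nat),
      [/\ prime_over 2 q, ramification_index 2 q e,
          1 <= alpha (Num.ceil (m%:R / e%:R : rat)),
          alpha (Num.ceil (m%:R / e%:R : rat)) <= s%:Z
        & forall p, prime p -> ~~ (p %| 2 * N1 * N2)%N ->
            ideal_exp q m (a1 p - a2 p)]].

Record weierstrass (F : Type) :=
  Weierstrass { wa1 : F; wa2 : F; wa3 : F; wa4 : F; wa6 : F }.

Definition wmap (F G : Type) (h : F -> G) (W : weierstrass F) : weierstrass G :=
  Weierstrass (h (wa1 W)) (h (wa2 W)) (h (wa3 W)) (h (wa4 W)) (h (wa6 W)).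

Section Invariants.
Variables (F : comNzRingType) (W : weierstrass F).
Local Notation a1 := (wa1 W).
Local Notation a2 := (wa2 W).
Local Notation a3 := (wa3 W).
Local Notation a4 := (wa4 W).
Local Notation a6 := (wa6 W).

Definition wb2 : F := a1 ^+ 2 + 4 * a2.
Definition wb4 : F := 2 * a4 + a1 * a3.
Definition wb6 : F := a3 ^+ 2 + 4 * a6.
Definition wb8 : F :=
  a1 ^+ 2 * a6 + 4 * a2 * a6 - a1 * a3 * a4 + a2 * a3 ^+ 2 - a4 ^+ 2.
Definition wc4 : F := wb2 ^+ 2 - 24 * wb4.
Definition wdisc : F :=
  - wb2 ^+ 2 * wb8 - 8 * wb4 ^+ 3 - 27 * wb6 ^+ 2 + 9 * wb2 * wb4 * wb6.

Definition on_affine (x y : F) : bool :=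
  y ^+ 2 + a1 * x * y + a3 * y == x ^+ 3 + a2 * x ^+ 2 + a4 * x + a6.

(* None is the point at infinity. *)
Definition on_curve (P : option (F * F)) : bool :=
  if P is Some (x, y) then on_affine x y else true.

End Invariants.

Definition elliptic_curve (F : fieldType) (W : weierstrass F) : Prop :=
  wdisc W != 0.

Section GroupLaw.
Variables (F : fieldType) (W : weierstrass F).

Definition point_add (P Q : option (F * F)) : option (F * F) :=
  match P, Q with
  | None, _ => Q
  | _, None => P
  | Some (x1, y1), Some (x2, y2) =>
    if (x1 == x2) && (y1 + y2 + wa1 W * x2 + wa3 W == 0) then None else
    let l := if x1 == x2
             then (3 * x1 ^+ 2 + 2 * wa2 W * x1 + wa4 W - wa1 W * y1)
                  / (2 * y1 + wa1 W * x1 + wa3 W)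
             else (y2 - y1) / (x2 - x1) in
    let x3 := l ^+ 2 + wa1 W * l - wa2 W - x1 - x2 in
    Some (x3, - (l + wa1 W) * x3 - (y1 - l * x1) - wa3 W)
  end.

Definition point_muln (n : nat) (P : option (F * F)) : option (F * F) :=
  iter n (point_add P) None.

Definition torsion_point (n : nat) (P : option (F * F)) : Prop :=
  on_curve W P /\ point_muln n P = None.

Definition proj_coord (P : option (F * F)) : 'I_3 -> F :=
  if P is Some (x, y) then tnth [tuple x; y; 1] else tnth [tuple 0; 1; 0].

End GroupLaw.

Definition mpoly_at (F : mpoly.mpoly 3 rat) (v : 'I_3 -> algC) : algC :=
  mpoly.meval v (mpoly.map_mpoly ratr F).

(* The map phi on points over algC (an algebraic closure of Q) is a
   nonconstant morphism of projective curves over Q preserving the origin: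
   near every point it is given by three homogeneous polynomials over Q of the
   same degree without common zero at that point. *)
Definition rational_isogeny (E E' : weierstrass rat)
    (phi : option (algC * algC) -> option (algC * algC)) : Prop :=
  let EC : weierstrass algC := wmap ratr E in
  let EC' : weierstrass algC := wmap ratr E' in
  [/\ phi None = None,
      forall P, on_curve EC P -> on_curve EC' (phi P),
      exists2 P, on_curve EC P & phi P <> None
    & forall P, on_curve EC P ->
      exists (d : nat) (F : 'I_3 -> mpoly.mpoly 3 rat),
      [/\ forall i, F i \is mpoly.ishomog1 d mpoly.mdeg,
          exists i, mpoly_at (F i) (proj_coord P) != 0
        & forall Q, on_curve EC Q ->
            (exists i, mpoly_at (F i) (proj_coord Q) != 0) ->
            exists2 c : algC, c != 0 &
              forall i, mpoly_at (F i) (proj_coord Q)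
                        = c * proj_coord (phi Q) i]].

(* The last clause says that g is an isomorphism from Z/4Z to the kernel. *)
Definition has_cyclic_rational_4_isogeny (E : weierstrass rat) : Prop :=
  exists (E' : weierstrass rat)
         (phi : option (algC * algC) -> option (algC * algC)),
  [/\ elliptic_curve E', rational_isogeny E E' phi
    & exists g : 'Z_4 -> option (algC * algC),
      [/\ injective g,
          forall i j, g (i + j) = point_add (wmap ratr E) (g i) (g j)
        & forall P, (on_curve (wmap ratr E) P /\ phi P = None)
                    <-> exists i, P = g i]].

(* Change of variables x = u^2 x' + r, y = u^3 y' + s u^2 x' + t. *)
Definition isomorphic (F : fieldType) (W W' : weierstrass F) : Prop :=
  exists u r s t : F,
    u != 0 /\
    [/\ u * wa1 W' = wa1 W + 2 * s,
        u ^+ 2 * wa2 W' = wa2 W - s * wa1 W + 3 * r - s ^+ 2,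
        u ^+ 3 * wa3 W' = wa3 W + r * wa1 W + 2 * t,
        u ^+ 4 * wa4 W' = wa4 W - s * wa3 W + 2 * r * wa2 W
                          - (t + r * s) * wa1 W + 3 * r ^+ 2 - 2 * s * t
      & u ^+ 6 * wa6 W' = wa6 W + r * wa4 W + r ^+ 2 * wa2 W + r ^+ 3
                          - t * wa3 W - t ^+ 2 - r * t * wa1 W].

Definition integral_model (E : weierstrass rat) (W : weierstrass int) : Prop :=
  isomorphic E (wmap intr W).

(* A model over Z_(p) becomes one over Z, with the same p-adic valuation of
   the discriminant, by a scaling prime to p; so it suffices to compare
   models over Z. *)
Definition minimal_model_at (p : nat) (E : weierstrass rat)
    (W : weierstrass int) : Prop :=
  integral_model E W /\
  forall W', integral_model E W' ->
    (logn p `|wdisc W|%N <= logn p `|wdisc W'|%N)%N.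

Definition reduction (p : nat) (W : weierstrass int) : weierstrass 'F_p :=
  wmap intr W.

(* A singular Weierstrass cubic has a node if c4 != 0 and a cusp if c4 = 0. *)
Definition good_reduction p W := wdisc (reduction p W) != 0.
Definition multiplicative_reduction p W :=
  (wdisc (reduction p W) == 0) && (wc4 (reduction p W) != 0).
Definition additive_reduction p W :=
  (wdisc (reduction p W) == 0) && (wc4 (reduction p W) == 0).

(* Trace of Frobenius p + 1 - #W(F_p), for a model W minimal at p. If the
   singular point of a bad reduction is counted, as here, the same formula
   yields 1, -1, 0 for split multiplicative, nonsplit multiplicative and
   additive reduction. *)
Definition frobenius_trace (p : nat) (W : weierstrass int) : int :=
  p%:Z - (#|[set u : 'F_p * 'F_p | on_affine (reduction p W) u.1 u.2]%SET|)%:Z.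

Section WildPart.
Variables (E : weierstrass rat) (l : nat) (L : splittingFieldType rat).
Local Notation EL := (wmap (ratr : rat -> L) E).

Definition seq_enumerates (T : eqType) (s : seq T) (A : set T) : Prop :=
  uniq s /\ forall x, x \in s <-> A x.

(* L is Q(E[l]) *)
Definition division_field : Prop :=
  (exists2 s : seq (option (L * L)),
     size s = (l ^ 2)%N & seq_enumerates s (torsion_point EL l)) /\
  forall U : {subfield L},
    (forall x y, torsion_point EL l (Some (x, y)) -> (x \in U) && (y \in U)) ->
    (U : {vspace L}) = fullv.

(* i-th ramification group (lower numbering) at the prime P *)
Definition ramification_group (P : set L) (i : nat) : {set gal_of {:L}} :=
  [set sigma : gal_of {:L} | `[< forall x : L, integers x ->
                     ideal_exp P i.+1 (sigma x - x) >]]%SET.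

Definition gal_point (sigma : gal_of {:L}) (Q : option (L * L)) :=
  omap (fun u => (sigma u.1, sigma u.2)) Q.

(* d is the dimension over F_l of the subspace of E[l] fixed by G *)
Definition fixed_torsion_dim (G : {set gal_of {:L}}) (d : nat) : Prop :=
  exists2 s : seq (option (L * L)), size s = (l ^ d)%N &
    seq_enumerates s
      [set Q | torsion_point EL l Q /\
               forall sigma, sigma \in G -> gal_point sigma Q = Q].

End WildPart.

(* delta = \sum_(i >= 1) (g_i / g_0) dim (E[l] / E[l]^(G_i)), where g_i = #G_i
   and l is a prime other than p; the value does not depend on l. *)
Definition wild_conductor_exponent (p : nat) (E : weierstrass rat)
    (delta : nat) : Prop :=
  exists (l : nat) (L : splittingFieldType rat) (P : set L)
         (n : nat) (d : nat -> nat),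
  [/\ prime l /\ l != p, division_field E l L, prime_over p P,
      forall i, (n <= i)%N -> ramification_group P i = [set 1%g]%SET
    & (forall i, fixed_torsion_dim E l (ramification_group P i) (d i)) /\
      (#|ramification_group P 0| * delta =
         \sum_(1 <= i < n) #|ramification_group P i| * (2 - d i))%N].

Definition conductor_exponent (p : nat) (E : weierstrass rat) (c : nat) : Prop :=
  exists W : weierstrass int,
  [/\ minimal_model_at p E W,
      good_reduction p W -> c = 0%N,
      multiplicative_reduction p W -> c = 1%N
    & additive_reduction p W ->
        exists2 delta, wild_conductor_exponent p E delta & c = (2 + delta)%N].

Definition conductor (E : weierstrass rat) (N : nat) : Prop :=
  (0 < N)%N /\ forall p, prime p -> conductor_exponent p E (logn p N).

(* The eigenform f with integral Fourier coefficients b, of weight 2 and level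
   the conductor N, having the L-function of E; the coefficients b at primes
   determine the others by the Hecke relations. *)
Definition corresponds_to_curve (R : realType) (E : weierstrass rat) (N : nat)
    (f : complex R -> complex R) (b : nat -> int) : Prop :=
  [/\ conductor E N,
      normalized_cuspidal_eigenform 2 N f (fun n => (b n)%:~R)
    & forall p W, prime p -> minimal_model_at p E W ->
        b p = frobenius_trace p W].

(* i = i_f(n), where a is the coefficient sequence of f *)
Definition gap_index (V : nmodType) (a : nat -> V) (n i : nat) : Prop :=
  if a n == 0
  then (forall j, (j <= i)%N -> a (n + j)%N = 0) /\
       (forall i', (forall j, (j <= i')%N -> a (n + j)%N = 0) -> (i' <= i)%N)
  else i = 0%N.

(* Main.v *)
Require Import Defs.
From HB Require Import structures.
From mathcomp Require Import all_boot all_order all_fingroup all_solvable all_algebra all_field.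
From mathcomp Require mpoly.
From mathcomp Require Import complex ring lra zify.
From mathcomp Require Import all_classical all_reals all_analysis.

Import Order.TTheory GRing.Theory Num.Theory.
Local Open Scope ring_scope.

(** Fewer than C n^{1/4} steps above n there is an integer n' = u ^ 2 + v ^ 2
    prime to 2 N M N_E at which the coefficient of f does not vanish; this is
    the whole theorem, since the gap at n cannot jump over n'.

    Such an n' is found greedily ([sum_two_squares_short_interval]): with
    Q = 2 N_f N_E, take the largest square (Q s + 1) ^ 2 below n, which leaves a
    remainder of order n^{1/2}, and then the least (Q t) ^ 2 above the remainder,
    which overshoots by a quantity of order n^{1/4}.  The congruence n' = 1 mod Q
    makes n' prime to the bad primes.

    By multiplicativity, a(n') is not zero as soon as no prime power p ^ r
    exactly dividing n' has a vanishing coefficient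
    ([coefficient_sum_two_squares_neq0]).  When p = 3 mod 4 the exponent r is
    even because n' is a sum of two squares; either a(p) is not zero and the
    property defining M applies, or a(p) = 0 and the Hecke recursion gives
    a(p ^ r) = (- p ^ (2k - 1)) ^ (r / 2).  When p = 1 mod 4 the claim is that
    a(p) is not zero, which is where the elliptic curve enters.

    A curve with a cyclic rational 4-isogeny has a_E(p) = p + 1 mod 4 at every
    odd prime of good reduction, hence a_E(p) = 2 mod 4 when p = 1 mod 4
    ([frobenius_trace_four_isogeny]).  Indeed, if g generates the kernel, then
    the automorphisms of the algebraic numbers permute the kernel, so they fix
    the abscissae x0 of 2 g and x1 of g, and both are rational
    ([four_isogeny_rational_halving]).  Rational x0 and x1 put the curve in the
    shape y ^ 2 = u (u ^ 2 + A u + D ^ 2), with A and D integral on a model over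
    the integers, and over a finite field such a curve has a number of points
    divisible by 4 ([card_halvable_origin_mod4]).

    Finally 2-adic closeness says that a(p) and a_E(p) are congruent modulo q ^ m
    with m > e, where e is the ramification index of q.  As 2 is exactly divisible
    by q ^ e, an integer that is 2 mod 4 is not in q ^ m
    ([twice_odd_notin_ideal_exp]), so a(p) cannot vanish. *)

Set Implicit Arguments.
Unset Strict Implicit.
Unset Printing Implicit Defensive.

(** * Counting points modulo 4 *)

(** A free action of the Klein four-group, given by two commuting involutions:
    the orbits have four elements, and removing one of them leaves a set on
    which the action is still free. *)
Lemma dvd4_card_four_group (T : finType) (s t : T -> T) (A : {set T}) :
  involutive s -> involutive t -> (forall x, s (t x) = t (s x)) ->
  (forall x, x \in A -> [/\ s x \in A, t x \in A, s x != x, t x != x & s x != t x]) ->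
  (4 %| #|A|)%N.
Proof.
move=> ss tt st; move: {2}#|A| (leqnn #|A|) => n; elim: n A => [|n IHn] A.
  by rewrite leqn0 => /eqP->.
move=> leAn freeA; have [->|[x Ax]] := finset.set_0Vmem A; first by rewrite cards0.
pose O := [set x; s x; t x; s (t x)].
have [sA tA sx tx stx] := freeA x Ax; have [stA _ _ _ _] := freeA _ tA.
have cardO : #|O| = 4%N.
  have stx' : s (t x) != x by apply: contraNneq stx => /(congr1 s); rewrite ss => ->.
  have stt : s (t x) != t x by have [] := freeA _ tA.
  have sts : s (t x) != s x by rewrite (inj_eq (inv_inj ss)).
  rewrite /O -finset.setUA -finset.setUA cardsU1 cardsU1 cards2 !inE /=.
  by rewrite !negb_or !(eq_sym x) sx tx stx' stx !(eq_sym _ (s (t x))) sts stt.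
have subO : O \subset A.
  by rewrite !finset.subUset !finset.sub1set Ax sA tA stA.
have -> : #|A| = (4 + #|A :\: O|)%N.
  by rewrite -cardO -(cardsID O A) (finset.setIidPr subO).
rewrite dvdn_addr //; apply: IHn.
  have : (4 + #|A :\: O| <= n.+1)%N.
    by apply: leq_trans leAn; rewrite -cardO -(cardsID O A) (finset.setIidPr subO).
  by move=> /(leq_trans _) => h; have := h (#|A :\: O|).+1 (leq_addl 3 _).
have sO y : (s y \in O) = (y \in O).
  have h z : (s y == z) = (y == s z) by rewrite -(inj_eq (inv_inj ss)) ss.
  rewrite !inE !h !ss.
  by case: (y == x); case: (y == s x); case: (y == t x); case: (y == s (t x)).
have tO y : (t y \in O) = (y \in O).
  have h z : (t y == z) = (y == t z) by rewrite -(inj_eq (inv_inj tt)) tt.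
  rewrite !inE !h st !tt.
  by case: (y == x); case: (y == s x); case: (y == t x); case: (y == t (s x)).
move=> y /finset.setDP[Ay Oy]; have [sAy tAy sy ty sty] := freeA y Ay.
by split=> //; apply/finset.setDP; rewrite ?sO ?tO.
Qed.

Section QuadraticCharacter.
Variable F : finFieldType.
Hypothesis two_neq0 : 2 != 0 :> F.

Definition is_square (c : F) : bool := [exists v, v ^+ 2 == c].

Lemma is_squareP c : reflect (exists v, v ^+ 2 = c) (is_square c).
Proof. exact: 'exists_eqP. Qed.

Lemma card_square_roots c : c != 0 ->
  #|[set v : F | v ^+ 2 == c]| = ((is_square c).*2)%N.
Proof.
move=> c0; have [/is_squareP[v Dc]|nsq] := boolP (is_square c); last first.
  apply/eqP; rewrite cards_eq0; apply/eqP/finset.setP => v; rewrite !inE.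
  by apply: contraNF nsq => /eqP Dc; apply/is_squareP; exists v.
have v0 : v != 0 by apply: contraNneq c0 => v0; rewrite -Dc v0 expr0n.
have -> : [set w : F | w ^+ 2 == c] = [set v; - v].
  by apply/finset.setP => w; rewrite !inE -Dc eqf_sqr.
by rewrite cards2 -subr_eq0 opprK -mulr2n -mulr_natl mulf_neq0.
Qed.

(** The nonzero elements are the powers of a generator of the cyclic group of
    units, and the nonsquares among them have odd exponent. *)
Lemma is_square_mul_nonsquares c d :
  ~~ is_square c -> ~~ is_square d -> is_square (c * d).
Proof.
have sq0 : is_square 0 by apply/is_squareP; exists 0; rewrite expr0n.
have [-> | c0] := eqVneq c 0; first by rewrite sq0.
have [-> | d0] := eqVneq d 0; first by rewrite sq0.
have /cyclicP[z Dz] := field_unit_group_cyclic [set: {unit F}]%G.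
have pow (x : F) : x != 0 -> exists i, x = val (z : {unit F}) ^+ i.
  move=> x0; have Ux : x \is a GRing.unit by rewrite unitfE.
  have /cycleP[i Di] : (FinRing.Unit Ux : {unit F}) \in <[z]>%g by rewrite -Dz inE.
  exists i; have -> : x = val (FinRing.Unit Ux : {unit F}) by [].
  rewrite Di; elim: (i) => [|m IHm]; first by rewrite expg0.
  by rewrite expgS exprS -IHm.
have [i ->] := pow c c0; have [j ->] := pow d d0; rewrite -exprD.
have sqr_even k : ~~ odd k -> is_square (val (z : {unit F}) ^+ k).
  move=> ek; apply/is_squareP; exists (val z ^+ k./2).
  by rewrite -exprM muln2 even_halfK.
move=> ni nj.
have oddi : odd i by apply: contraNT ni; exact: sqr_even.
have oddj : odd j by apply: contraNT nj; exact: sqr_even.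
by apply: sqr_even; rewrite oddD oddi oddj.
Qed.

Lemma is_square_mul c d : c != 0 -> is_square c -> is_square (c * d) = is_square d.
Proof.
move=> c0 /is_squareP[v Dc]; have v0 : v != 0 by apply: contraNneq c0 => v0; rewrite -Dc v0 expr0n.
apply/is_squareP/is_squareP => [[w Dw]|[w Dw]].
  by exists (w / v); rewrite expr_div_n Dw Dc mulrAC mulfV ?mul1r.
by exists (v * w); rewrite exprMn Dc Dw.
Qed.

(** The curve y ^ 2 = u (u ^ 2 + A u + D ^ 2) has, with the point at infinity, a
    number of points divisible by 4.  Leaving (0, 0) aside, put v = y / u, so
    that the equation becomes u v ^ 2 = u ^ 2 + A u + D ^ 2.  Negation
    (u, v) -> (u, - v) and (u, v) -> (D ^ 2 / u, v) generate a four-group acting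
    on the solutions; the points with a nontrivial stabilizer are those with
    v = 0, u = D or u = - D, in number 0 or 2 each according to whether
    A ^ 2 - 4 D ^ 2, A + 2 D or A - 2 D is a square.  The first of these
    elements is the product of the two others, so an odd number of the three
    are squares. *)
Lemma card_halvable_origin_mod4 (A D : F) : D != 0 -> A ^+ 2 - 4 * D ^+ 2 != 0 ->
  (#|[set w : F * F | w.2 ^+ 2 == w.1 * (w.1 ^+ 2 + A * w.1 + D ^+ 2)]%R| = 3 %[mod 4])%N.
Proof.
move=> D0 disc0; set S := [set w | _].
have four0 : 4 != 0 :> F by rewrite (_ : 4 = 2 * 2) ?mulf_neq0 //; ring.
have := disc0; rewrite (_ : A ^+ 2 - 4 * D ^+ 2 = (A + 2 * D) * (A - 2 * D)); last by ring.
rewrite mulf_eq0 negb_or => /andP[cp cm].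
pose Q := [set w : F * F | w.1 * w.2 ^+ 2 == w.1 ^+ 2 + A * w.1 + D ^+ 2].
have Q0 w : w \in Q -> w.1 != 0.
  rewrite inE; apply: contraTneq => ->; rewrite expr0n mulr0 mul0r !add0r eq_sym.
  by rewrite expf_eq0.
have -> : #|S| = (1 + #|Q|)%N.
  have -> : S = (0, 0) |: [set (w.1, w.1 * w.2) | w in Q].
    apply/finset.setP => [[u y]]; rewrite in_setU1 inE /= xpair_eqE.
    apply/idP/idP.
      have [-> /=|u0 /= /eqP Dy] := eqVneq u 0.
        by rewrite mul0r expf_eq0 /= => ->.
      apply/imsetP; exists (u, y / u); last by rewrite /= mulrC divfK.
      rewrite inE /= expr_div_n Dy; apply/eqP; field.
      exact: u0.
    case/orP => [/andP[/eqP-> /eqP->]|]; first by rewrite mul0r expr0n.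
    case/imsetP => -[u' v]; rewrite inE /= => /eqP Dv [-> ->].
    by rewrite -Dv; apply/eqP; ring.
  rewrite cardsU1 card_in_imset => [|[u v] [u' v'] Quv Quv' /= [<- /mulfI-> //]]; last first.
    exact: (Q0 _ Quv).
  case: imsetP => //= -[w /Q0 w0 [/esym h _]]; by rewrite h eqxx in w0.
pose s (w : F * F) := (w.1, - w.2); pose t (w : F * F) := (D ^+ 2 / w.1, w.2).
pose F1 := [set w : F * F | (w.2 == 0) && (w.1 ^+ 2 + A * w.1 + D ^+ 2 == 0)].
pose F2 := [set w : F * F | (w.1 == D) && (w.2 ^+ 2 == A + 2 * D)].
pose F3 := [set w : F * F | (w.1 == - D) && (w.2 ^+ 2 == A - 2 * D)].
have DNd : D != - D by rewrite -subr_eq0 opprK -mulr2n -mulr_natl mulf_neq0.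
have F1Q : F1 = Q :&: [set w | w.2 == 0].
  apply/finset.setP => -[u v]; rewrite !inE /=.
  have [->|_] := eqVneq v 0; last by rewrite andbF.
  by rewrite andbT expr0n mulr0 eq_sym.
have F2Q : F2 = Q :&: [set w | w.1 == D].
  apply/finset.setP => -[u v]; rewrite !inE /=.
  have [->|_] := eqVneq u D; last by rewrite andbF.
  rewrite andbT /= -(inj_eq (mulfI D0)); congr (_ == _); ring.
have F3Q : F3 = Q :&: [set w | w.1 == - D].
  apply/finset.setP => -[u v]; rewrite !inE /=.
  have [->|_] := eqVneq u (- D); last by rewrite andbF.
  rewrite andbT /= -(inj_eq (mulfI D0)) -(inj_eq oppr_inj) -mulNr; congr (_ == _); ring.
have cardF1 : #|F1| = (is_square ((A + 2 * D) * (A - 2 * D))%R).*2%N.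
  rewrite -card_square_roots ?mulf_neq0 //.
  have -> : F1 = (fun v => ((v - A) / 2, 0)) @: [set v | v ^+ 2 == (A + 2 * D) * (A - 2 * D)].
    apply/finset.setP => -[u v]; rewrite inE /=; apply/andP/imsetP => [[/eqP-> /eqP h]|].
      exists (2 * u + A); last by rewrite addrK mulrAC mulfV ?mul1r.
      rewrite inE -subr_eq0; apply/eqP.
      have -> : (2 * u + A) ^+ 2 - (A + 2 * D) * (A - 2 * D) =
        4 * (u ^+ 2 + A * u + D ^+ 2) by ring.
      by rewrite h mulr0.
    case=> r; rewrite inE => /eqP h [-> ->]; split=> //; apply/eqP.
    have -> : ((r - A) / 2) ^+ 2 + A * ((r - A) / 2) + D ^+ 2 =
        (r ^+ 2 - (A + 2 * D) * (A - 2 * D)) / 4 by field; rewrite ?four0 ?two_neq0.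
    by rewrite h subrr mul0r.
  rewrite card_imset // => r r' [] /(mulIf _) h; apply: (addIr (- A)).
  by apply: h; rewrite invr_eq0.
have cardF2 : #|F2| = (is_square (A + 2 * D)%R).*2%N.
  rewrite -card_square_roots //.
  have -> : F2 = (fun v => (D, v)) @: [set v | v ^+ 2 == A + 2 * D].
    apply/finset.setP => -[u v]; rewrite inE /=; apply/andP/imsetP => [[/eqP-> h]|].
      by exists v; rewrite ?inE.
    by case=> r; rewrite inE => h [-> ->].
  by rewrite card_imset // => r r' [].
have cardF3 : #|F3| = (is_square (A - 2 * D)%R).*2%N.
  rewrite -card_square_roots //.
  have -> : F3 = (fun v => (- D, v)) @: [set v | v ^+ 2 == A - 2 * D].
    apply/finset.setP => -[u v]; rewrite inE /=; apply/andP/imsetP => [[/eqP-> h]|].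
      by exists v; rewrite ?inE.
    by case=> r; rewrite inE => h [-> ->].
  by rewrite card_imset // => r r' [].
(* F1, F2 and F3 are disjoint: neither A + 2 D nor A - 2 D is 0, and D is
   not - D. *)
pose Q1 := Q :\: F1; pose Q2 := Q1 :\: F2; pose Q3 := Q2 :\: F3.
have DQ : #|Q| = (#|F1| + (#|F2| + (#|F3| + #|Q3|)))%N.
  have I1 : Q :&: F1 = F1 by rewrite F1Q finset.setIA finset.setIid.
  have I2 : Q1 :&: F2 = F2.
    apply/finset.setIidPr/fintype.subsetP => w; rewrite finset.in_setD => F2w.
    have /finset.setIP[-> _] : w \in Q :&: [set w | w.1 == D] by rewrite -F2Q.
    rewrite andbT F1Q !inE; move: F2w; rewrite inE => /andP[_].
    by apply: contraTN => /andP[_ /eqP->]; rewrite expr0n eq_sym.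
  have I3 : Q2 :&: F3 = F3.
    apply/finset.setIidPr/fintype.subsetP => w; rewrite !finset.in_setD => F3w.
    have /finset.setIP[-> _] : w \in Q :&: [set w | w.1 == - D] by rewrite -F3Q.
    rewrite andbT F1Q F2Q !inE; move: F3w; rewrite inE => /andP[/eqP-> w2].
    rewrite (eq_sym _ D) (negPf DNd) andbF /=.
    by move: w2; apply: contraTN => /andP[_ /eqP->]; rewrite expr0n eq_sym.
  by rewrite -(cardsID F1 Q) I1 -/Q1 -(cardsID F2 Q1) I2 -/Q2 -(cardsID F3 Q2) I3.
have dvQ3 : (4 %| #|Q3|)%N.
  have sS w : (s w \in Q) = (w \in Q) by rewrite !inE /= sqrrN.
  have tS w : w.1 != 0 -> (t w \in Q) = (w \in Q).
    case: w => u v /= u0; rewrite !inE /=.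
    rewrite -(inj_eq (mulfI (_ : u ^+ 2 / D ^+ 2 != 0))); last first.
      by rewrite mulf_neq0 ?invr_eq0 ?expf_neq0.
    congr (_ == _); field; by rewrite ?u0 ?D0.
  apply: (dvd4_card_four_group (s := s) (t := t)) => [[u v]|[u v]|[u v]|w].
  - by rewrite /s /= opprK.
  - by rewrite /t /= invf_div mulrA mulrAC mulfV ?mul1r ?expf_neq0.
  - by [].
  have Q3E w' : (w' \in Q3) = [&& w' \in Q, w'.2 != 0, w'.1 != D & w'.1 != - D].
    rewrite !finset.in_setD F1Q F2Q F3Q !finset.in_setI.
    case: (w' \in Q); rewrite ?andbF //= ?andbT !inE.
    by case: (w'.2 == 0); case: (w'.1 == D); case: (w'.1 == - D).
  rewrite !Q3E => /and4P[Qw v0 uD uD']; have u0 := Q0 _ Qw.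
  have vv : - w.2 != w.2 by rewrite eq_sym -subr_eq0 opprK -mulr2n -mulr_natl mulf_neq0.
  (* s and its composite with t change the sign of v, which is not 0, and t
     fixes only the points with u = D or u = - D. *)
  have tE e : e != 0 -> (D ^+ 2 / w.1 == e) = (w.1 == D ^+ 2 / e).
    by move=> e0; apply/eqP/eqP => [<-|->]; field; rewrite ?u0 ?e0 D0.
  split.
  - by rewrite sS Qw /= oppr_eq0 v0 uD.
  - rewrite tS // Qw /= v0 !tE ?oppr_eq0 // invrN mulrN expr2 mulfK //.
    by rewrite uD uD'.
  - by apply: contraNneq vv => /(congr1 snd) /= ->.
  - apply: contraNneq uD' => /(congr1 fst) /= /eqP; rewrite tE // -(inj_eq (mulIf u0)) divfK //.
    by rewrite -expr2 eqf_sqr (negPf uD).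
  - by apply: contraNneq vv => /(congr1 snd) /= ->.
(* Three cases of quadratic characters: an odd number of squares in each. *)
move/dvdnP: dvQ3 => [k Dk]; rewrite DQ Dk cardF1 cardF2 cardF3.
have [sp|np] := boolP (is_square (A + 2 * D)).
  by rewrite is_square_mul //; move: (is_square _) => sm; clear -k; case: sm => /=; lia.
have [sm|nm] := boolP (is_square (A - 2 * D)).
  by rewrite mulrC is_square_mul // (negPf np); clear -k; lia.
by rewrite is_square_mul_nonsquares //; clear -k; lia.
Qed.

End QuadraticCharacter.

(** * Rationality of the abscissae of a cyclic kernel *)

(** The conjugates of x generate a Galois extension of the rationals, each
    element of whose Galois group extends to an automorphism of [algC]; so x
    lies in the fixed field. *)
Lemma fixed_by_automorphisms_rational (x : algC) :
  (forall nu : {rmorphism algC -> algC}, nu x = x) -> x \in Crat.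
Proof.
move=> fix_x; have [p [_ mon_p] dv_p] := minCpolyP x.
have px0 : root (map_poly ratr p) x by rewrite dv_p.
have [r Dr] := closed_field_poly_normal (map_poly ratr p : {poly algC}).
rewrite lead_coef_map (monicP mon_p) rmorph1 scale1r in Dr.
have rx: x \in r by rewrite -root_prod_XsubC -Dr.
have [L [LC [rr Drr genL]]] := num_field_exists r.
have [y _ Dy]: exists2 y, y \in rr & x = LC y by apply/mapP; rewrite Drr.
pose q := map_poly (in_alg L) p.
have Qq : q \is a polyOver 1%VS.
  by apply/polyOverP=> i; rewrite coef_map memvZ ?memv_line.
have splitL : splittingFieldFor 1 q {:L}.
  exists rr => //; congr (_ %= _): (eqpxx q); apply/(map_poly_inj LC).
  rewrite rmorph_prod /= -map_poly_comp.
  under [RHS]eq_bigr => z _ do rewrite map_polyXsubC.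
  rewrite -[RHS](big_map LC predT (fun z => 'X - z%:P)) Drr -Dr.
  by apply: eq_map_poly => a; rewrite /= rmorphZ_num rmorph1 mulr1.
have L_split : FieldExt_isSplittingField _ L by constructor; exists q.
pose S : splittingFieldType rat := HB.pack_for (splittingFieldType rat) L L_split.
have galS : galois 1 {:S}.
  rewrite /galois sub1v; apply/and3P; split=> //.
    apply/separableP=> z _; apply: pcharf0_separable => i.
    by rewrite pchar_lalg pchar_num.
  by apply/splitting_normalField; rewrite ?sub1v //; exists q.
have fix_y : (y : S) \in fixedField 'Gal({:S} / 1)%g.
  apply/fixedFieldP; rewrite ?memvf // => g _.
  have [nu Dnu] := extend_algC_subfield_aut (LC : {rmorphism S -> algC}) g.
  by apply: (fmorph_inj LC); rewrite [LHS]Dnu -Dy fix_x.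
have /galois_fixedField galE := galS; rewrite galE in fix_y.
have /vlineP[a Da] := fix_y.
by apply/CratP; exists a; rewrite Dy Da alg_num_field fmorph_rat.
Qed.

(** The right-hand side of the equation (2 y + a1 x + a3) ^ 2 = 4 x ^ 3 + ...
    obtained by completing the square: away from characteristic 2 its
    roots are the abscissae of the points of order 2. *)
Definition two_division_poly (K : comNzRingType) (W : weierstrass K) x :=
  4 * x ^+ 3 + wb2 W * x ^+ 2 + 2 * wb4 W * x + wb6 W.

(** Half the derivative of [two_division_poly].  When (x0, y0) has order 2 and
    (x1, y1) doubles to it, this polynomial at x0 is 2 (x0 - x1) ^ 2; on the
    model y ^ 2 = x (x ^ 2 + a x + b) with x0 = 0 this says x1 ^ 2 = b. *)
Definition halving_poly (K : comNzRingType) (W : weierstrass K) x :=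
  6 * x ^+ 2 + wb2 W * x + wb4 W.

Section TwoDivision.
Variables (F : fieldType) (W : weierstrass F).

(** The tangent at (x1, y1), of slope l, meets the cubic again at (x0, y0)
    (which is its own opposite).  Restricted to this line the equation of the
    curve becomes (x - x0) (x - x1) ^ 2, whose derivative at x0 is
    (x0 - x1) ^ 2. *)
Lemma tangent_through_two_torsion x0 y0 x1 y1 l :
  on_affine W x0 y0 -> on_affine W x1 y1 -> (x0, y0) <> (x1, y1) ->
  y0 + y0 + wa1 W * x0 + wa3 W = 0 ->
  x0 = l ^+ 2 + wa1 W * l - wa2 W - x1 - x1 ->
  y0 = - (l + wa1 W) * x0 - (y1 - l * x1) - wa3 W ->
  2 * (x0 - x1) ^+ 2 = halving_poly W x0.
Proof.
rewrite /on_affine /halving_poly /wb2 /wb4; case: W => a1 a2 a3 a4 a6 /=.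
move=> /eqP E0 /eqP E1 neq T0 Ex Ey.
have D3 : a3 = - (2 * y0) - a1 * x0.
  by apply/eqP; rewrite -subr_eq0 -T0; apply/eqP; ring.
have D1 : y1 = y0 + l * (x1 - x0).
  have -> : y1 = - (l + a1) * x0 + l * x1 - a3 - y0 by rewrite Ey; ring.
  by rewrite D3; ring.
have D2 : a2 = l ^+ 2 + a1 * l - x0 - 2 * x1 by rewrite [in RHS]Ex; ring.
have d0 : x1 - x0 != 0.
  by apply/eqP => d0; apply: neq; rewrite D1 d0 mulr0 addr0 -[x1](subrK x0) d0 add0r.
have key : (x1 - x0) * (3 * x0 ^+ 2 + 2 * a2 * x0 + a4 - a1 * y0 - (x0 - x1) ^+ 2) =
  (x1 ^+ 3 + a2 * x1 ^+ 2 + a4 * x1 + a6 - (y1 ^+ 2 + a1 * x1 * y1 + a3 * y1)) -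
  (x0 ^+ 3 + a2 * x0 ^+ 2 + a4 * x0 + a6 - (y0 ^+ 2 + a1 * x0 * y0 + a3 * y0)).
  by rewrite D1 D3 D2; ring.
have : 3 * x0 ^+ 2 + 2 * a2 * x0 + a4 - a1 * y0 = (x0 - x1) ^+ 2.
  by apply/eqP; rewrite -subr_eq0 -(mulrI_eq0 _ (lregP d0)) key E0 E1 !subrr.
by move=> <-; rewrite D3; ring.
Qed.

Lemma two_torsion_x x0 y0 : on_affine W x0 y0 ->
  y0 + y0 + wa1 W * x0 + wa3 W = 0 ->
  two_division_poly W x0 = 0.
Proof.
rewrite /on_affine /two_division_poly /wb2 /wb4 /wb6.
case: W => a1 a2 a3 a4 a6 /= /eqP E0 T0.
have -> : 4 * x0 ^+ 3 + (a1 ^+ 2 + 4 * a2) * x0 ^+ 2 +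
    2 * (2 * a4 + a1 * a3) * x0 + (a3 ^+ 2 + 4 * a6)
  = (y0 + y0 + a1 * x0 + a3) ^+ 2 +
    4 * (x0 ^+ 3 + a2 * x0 ^+ 2 + a4 * x0 + a6 - (y0 ^+ 2 + a1 * x0 * y0 + a3 * y0)).
  by ring.
by rewrite E0 T0 subrr mulr0 expr0n addr0.
Qed.

End TwoDivision.

Section BaseChange.
Variables (F G : fieldType) (h : {rmorphism F -> G}).

Definition map_point : option (F * F) -> option (G * G) :=
  omap (fun u => (h u.1, h u.2)).

Lemma on_affine_map W x y : on_affine (wmap h W) (h x) (h y) = on_affine W x y.
Proof.
rewrite /on_affine /= -(inj_eq (fmorph_inj h)).
by rewrite !(rmorphD, rmorphM, rmorphXn).
Qed.

Lemma on_curve_map W P : on_curve (wmap h W) (map_point P) = on_curve W P.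
Proof. by case: P => [[x y]|] //=; apply: on_affine_map. Qed.

Lemma point_add_map W P Q :
  map_point (point_add W P Q) = point_add (wmap h W) (map_point P) (map_point Q).
Proof.
case: P Q => [[x1 y1]|] [[x2 y2]|] //=.
rewrite -!rmorphM -!rmorphD fmorph_eq0 (inj_eq (fmorph_inj h)).
case: ifP => //= _; congr Some.
by case: ifP => _;
  rewrite !(rmorphD, rmorphM, rmorphB, rmorphN, rmorphXn, fmorphV) /= ?rmorph1.
Qed.

Lemma two_division_poly_map W x :
  two_division_poly (wmap h W) (h x) = h (two_division_poly W x).
Proof.
rewrite /two_division_poly /wb2 /wb4 /wb6.
by rewrite !(rmorphD, rmorphM, rmorphXn) /= ?rmorph1.
Qed.

Lemma halving_poly_map W x x' :
  2 * (h x - h x') ^+ 2 - halving_poly (wmap h W) (h x) =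
  h (2 * (x - x') ^+ 2 - halving_poly W x).
Proof.
rewrite /halving_poly /wb2 /wb4.
by rewrite !(rmorphB, rmorphD, rmorphM, rmorphXn) /= ?rmorph1.
Qed.

End BaseChange.

(** Algebraic points of a curve over the rationals, under the automorphisms of
    the field of algebraic numbers. *)
Section GaloisAction.
Variable nu : {rmorphism algC -> algC}.
Local Notation galois_act := (map_point nu).

Lemma proj_coord_act P i : proj_coord (galois_act P) i = nu (proj_coord P i).
Proof.
by case: P => [[x y]|]; case: i => [[|[|[|//]]] ?] /=; rewrite ?rmorph0 ?rmorph1.
Qed.

Lemma mpoly_at_act F v : mpoly_at F (fun i => nu (v i)) = nu (mpoly_at F v).
Proof.
rewrite /mpoly_at !mpoly.mevalE rmorph_sum; apply: eq_bigr => m _.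
rewrite mpoly.mcoeff_map_mpoly rmorphM rmorph_prod /= fmorph_rat; congr (_ * _).
by apply: eq_bigr => i _; rewrite rmorphXn.
Qed.

Variable E : weierstrass rat.
Let EC : weierstrass algC := wmap ratr E.

Lemma wmap_aut_rat : wmap nu EC = EC.
Proof. by rewrite /EC /wmap /= !fmorph_rat. Qed.

Lemma on_curve_act P : on_curve EC P -> on_curve EC (galois_act P).
Proof. by rewrite -{2}wmap_aut_rat on_curve_map. Qed.

Lemma point_add_act P Q :
  galois_act (point_add EC P Q) = point_add EC (galois_act P) (galois_act Q).
Proof. by rewrite point_add_map wmap_aut_rat. Qed.

(** Where phi is given by the forms F over the rationals, P is in the kernel
    when the third form vanishes at P, and this condition is stable under
    automorphisms. *)
Lemma kernel_act E' phi P : rational_isogeny E E' phi ->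
  on_curve EC P -> phi P = None -> phi (galois_act P) = None.
Proof.
case=> _ _ _ loc onP phiP; have [d [F [_ nzP Fphi]]] := loc P onP.
have [c c0 Fc] := Fphi P onP nzP.
have [i nzi] := nzP.
have actE j : mpoly_at (F j) (proj_coord (galois_act P)) =
    nu (mpoly_at (F j) (proj_coord P)).
  rewrite -mpoly_at_act; congr (mpoly_at _ _); apply: funext => k.
  exact: proj_coord_act.
have [|c' c'0 Fc'] := Fphi (galois_act P) (on_curve_act onP).
  by exists i; rewrite actE fmorph_eq0.
have := Fc' ord_max; rewrite actE Fc phiP /=.
case: (phi _) => [[x y]|] //.
rewrite /= /tnth /= mulr0 rmorph0 mulr1 => /esym/eqP.
by rewrite (negPf c'0).
Qed.

End GaloisAction.

(** Every automorphism nu permutes the kernel, compatibly with addition.  It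
    maps the generator g 1 to an element j whose double is not trivial, hence to
    one of the opposite points g 1 and g 3, and it fixes g 2. *)
Lemma four_isogeny_rational_halving (E : weierstrass rat) :
  has_cyclic_rational_4_isogeny E ->
  exists x0 x1 : rat,
    two_division_poly E x0 = 0 /\
    2 * (x0 - x1) ^+ 2 = halving_poly E x0.
Proof.
case=> E' [phi [_ isog [g [g_inj gD kerP]]]].
pose EC : weierstrass algC := wmap ratr E.
have ong i : on_curve EC (g i) by have [] := (kerP (g i)).2 (ex_intro _ i erefl).
have g0 : g 0 = None.
  have [phi0 _ _ _] := isog.
  have [i Di] := (kerP None).1 (conj isT phi0).
  have /g_inj : g (i + i) = g i by rewrite gD -Di.
  by move=> /eqP; rewrite -subr_eq0 addrK => /eqP Di0; rewrite Di Di0.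
have Z4 (j : 'Z_4) : [\/ j = 0, j = 1, j = 1 + 1 | j = 1 + 1 + 1].
  by case: j => [[|[|[|[|//]]]] ?];
    [apply: Or41|apply: Or42|apply: Or43|apply: Or44]; apply: val_inj.
have nontriv i : i != 0 -> exists x y, g i = Some (x, y).
  move=> i0; case Di : (g i) => [[x y]|]; first by exists x, y.
  by case/eqP: i0; apply: g_inj; rewrite Di g0.
have [x1 [y1 D1]] := nontriv 1 isT.
have [x0 [y0 D0]] := nontriv (1 + 1) isT.
have [x3 [y3 D3]] := nontriv (1 + 1 + 1) isT.
have x31 : x3 = x1.
  have := gD (1 + 1 + 1) 1; rewrite [X in g X](_ : _ = 0); last exact: val_inj.
  by rewrite g0 D3 D1 /=; case: eqP.
have T0 : y0 + y0 + wa1 EC * x0 + wa3 EC = 0.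
  have := gD (1 + 1) (1 + 1); rewrite [X in g X](_ : _ = 0); last exact: val_inj.
  by rewrite g0 D0 /= eqxx /=; case: eqP.
have fixed (nu : {rmorphism algC -> algC}) : nu x0 = x0 /\ nu x1 = x1.
  have [j Dj] : exists j, map_point nu (g 1) = g j.
    apply/kerP; split; first exact: on_curve_act.
    apply: kernel_act isog _ _; first exact: ong.
    by have [] := (kerP (g 1)).2 (ex_intro _ 1 erefl).
  have D2 : map_point nu (g (1 + 1)) = g (j + j).
    have D11 : g (1 + 1) = point_add EC (g 1) (g 1) := gD 1 1.
    have Djj : g (j + j) = point_add EC (g j) (g j) := gD j j.
    by rewrite Djj -Dj D11; apply: point_add_act.
  have odd_j : j + j = 1 + 1 -> nu x0 = x0.
    by move=> jj; move: D2; rewrite jj D0 => -[].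
  case: (Z4 j) => Ej; rewrite Ej in D2 Dj odd_j.
  - by rewrite addr0 g0 D0 in D2.
  - by rewrite odd_j //; move: Dj; rewrite D1 => -[].
  - have jj : 1 + 1 + (1 + 1) = 0 :> 'Z_4 by apply: val_inj.
    by rewrite jj g0 D0 in D2.
  - rewrite odd_j; last exact: val_inj.
    by move: Dj; rewrite D1 D3 x31 => -[].
have /CratP[r0 E0] : x0 \in Crat.
  by apply: fixed_by_automorphisms_rational => nu; have [] := fixed nu.
have /CratP[r1 E1] : x1 \in Crat.
  by apply: fixed_by_automorphisms_rational => nu; have [] := fixed nu.
have on0 : on_affine EC x0 y0 by have := ong (1 + 1); rewrite D0.
have on1 : on_affine EC x1 y1 by have := ong 1; rewrite D1.
pose ratrm : {rmorphism rat -> algC} := ratr.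
have T : two_division_poly EC x0 = 0 := two_torsion_x on0 T0.
have H : 2 * (x0 - x1) ^+ 2 = halving_poly EC x0.
  have := gD 1 1; rewrite D0 D1 /=; case: ifP => // _ [].
  rewrite eqxx; move: (_ / _) => l Ex Ey.
  apply: (tangent_through_two_torsion on0 on1 _ T0 (l := l)) => //.
    by case=> Dx Dy; have /g_inj/(congr1 val) : g (1 + 1) = g 1 by rewrite D0 D1 Dx Dy.
  by rewrite {1}Ey Ex.
exists r0, r1; split; last apply: subr0_eq; apply: (fmorph_inj ratrm); rewrite rmorph0.
  by rewrite -[LHS](two_division_poly_map ratrm) -[RHS]T E0.
have {}H : 2 * (x0 - x1) ^+ 2 - halving_poly EC x0 = 0 by rewrite H subrr.
by rewrite -[LHS](halving_poly_map ratrm) -[RHS]H E0 E1.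
Qed.

(** * Reduction of a curve with a rational 4-isogeny *)

Section Isomorphism.
Variables (F : fieldType) (W W' : weierstrass F) (u r s t : F).
Hypothesis u0 : u != 0.
Hypothesis iso : [/\ u * wa1 W' = wa1 W + 2 * s,
        u ^+ 2 * wa2 W' = wa2 W - s * wa1 W + 3 * r - s ^+ 2,
        u ^+ 3 * wa3 W' = wa3 W + r * wa1 W + 2 * t,
        u ^+ 4 * wa4 W' = wa4 W - s * wa3 W + 2 * r * wa2 W
                          - (t + r * s) * wa1 W + 3 * r ^+ 2 - 2 * s * t
      & u ^+ 6 * wa6 W' = wa6 W + r * wa4 W + r ^+ 2 * wa2 W + r ^+ 3
                          - t * wa3 W - t ^+ 2 - r * t * wa1 W].

Lemma wb2_change : u ^+ 2 * wb2 W' = wb2 W + 12 * r.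
Proof.
have [I1 I2 _ _ _] := iso; rewrite /wb2.
have -> : u ^+ 2 * (wa1 W' ^+ 2 + 4 * wa2 W') =
  (u * wa1 W') ^+ 2 + 4 * (u ^+ 2 * wa2 W') by ring.
by rewrite I1 I2; ring.
Qed.

Lemma wb4_change : u ^+ 4 * wb4 W' = wb4 W + r * wb2 W + 6 * r ^+ 2.
Proof.
have [I1 _ I3 I4 _] := iso; rewrite /wb2 /wb4.
have -> : u ^+ 4 * (2 * wa4 W' + wa1 W' * wa3 W') =
   2 * (u ^+ 4 * wa4 W') + (u * wa1 W') * (u ^+ 3 * wa3 W') by ring.
by rewrite I1 I3 I4; ring.
Qed.

Lemma wb6_change : u ^+ 6 * wb6 W' = wb6 W + 2 * r * wb4 W + r ^+ 2 * wb2 W + 4 * r ^+ 3.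
Proof.
have [_ _ I3 _ I6] := iso; rewrite /wb2 /wb4 /wb6.
have -> : u ^+ 6 * (wa3 W' ^+ 2 + 4 * wa6 W') =
  (u ^+ 3 * wa3 W') ^+ 2 + 4 * (u ^+ 6 * wa6 W') by ring.
by rewrite I3 I6; ring.
Qed.

Lemma two_division_poly_change x :
  u ^+ 6 * two_division_poly W' ((x - r) / u ^+ 2) = two_division_poly W x.
Proof.
rewrite /two_division_poly.
have -> : wb2 W' = (wb2 W + 12 * r) / u ^+ 2 by rewrite -wb2_change; field.
have -> : wb4 W' = (wb4 W + r * wb2 W + 6 * r ^+ 2) / u ^+ 4 by rewrite -wb4_change; field.
have -> : wb6 W' = (wb6 W + 2 * r * wb4 W + r ^+ 2 * wb2 W + 4 * r ^+ 3) / u ^+ 6.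
  by rewrite -wb6_change; field.
by field.
Qed.

Lemma halving_poly_change x x' :
  u ^+ 4 * (2 * ((x - r) / u ^+ 2 - (x' - r) / u ^+ 2) ^+ 2 -
    halving_poly W' ((x - r) / u ^+ 2)) =
  2 * (x - x') ^+ 2 - halving_poly W x.
Proof.
rewrite /halving_poly.
have -> : wb2 W' = (wb2 W + 12 * r) / u ^+ 2 by rewrite -wb2_change; field.
have -> : wb4 W' = (wb4 W + r * wb2 W + 6 * r ^+ 2) / u ^+ 4 by rewrite -wb4_change; field.
by field.
Qed.

End Isomorphism.

Lemma rational_root_monic_int (p : {poly int}) (x : rat) :
  p \is monic -> root (map_poly intr p) x -> exists n : int, x = n%:~R.
Proof.
move=> mon_p px0.
have Zx : (ratr x : algC) \in Num.int.
  apply: Cint_rat_Aint; first exact: Crat_rat.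
  apply: (root_monic_Aint (p := map_poly intr p)); last 1 first.
  - by apply/polyOverP => i; rewrite coef_map /= intr_int.
  - rewrite -(fmorph_root (ratr : {rmorphism rat -> algC})) -map_poly_comp in px0.
    by rewrite (eq_map_poly (f := intr) (g := ratr \o intr)) // => i /=; rewrite ratr_int.
  - exact: monic_map.
have /intrP[n Dn] := Zx; exists n.
by apply: (fmorph_inj (ratr : {rmorphism rat -> algC})); rewrite /= ratr_int.
Qed.

(** Multiplying by 4 makes the two numbers integral: 4 x0 is a root of the monic
    polynomial X ^ 3 + b2 X ^ 2 + 8 b4 X + 16 b6, and the square of
    D = 4 (x0 - x1) is an integer. *)
Lemma integral_halving (W : weierstrass int) (x0 x1 : rat) :
  two_division_poly (wmap intr W) x0 = 0 ->
  2 * (x0 - x1) ^+ 2 = halving_poly (wmap intr W) x0 ->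
  exists X0 D : int,
    X0 ^+ 3 + wb2 W * X0 ^+ 2 + 8 * wb4 W * X0 + 16 * wb6 W = 0 /\
    D ^+ 2 = 3 * X0 ^+ 2 + 2 * wb2 W * X0 + 8 * wb4 W.
Proof.
rewrite /two_division_poly /halving_poly.
have -> : wb2 (wmap intr W) = (wb2 W)%:~R :> rat by rewrite /wb2 /=; ring.
have -> : wb4 (wmap intr W) = (wb4 W)%:~R :> rat by rewrite /wb4 /=; ring.
have -> : wb6 (wmap intr W) = (wb6 W)%:~R :> rat by rewrite /wb6 /=; ring.
move: (wb2 W) (wb4 W) (wb6 W) => b2 b4 b6 T H.
have [X0 DX] : exists n : int, 4 * x0 = n%:~R.
  apply: (@rational_root_monic_int (Poly [:: 16 * b6; 8 * b4; b2; 1])).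
    by rewrite monicE lead_coefE (PolyK (c := 0)).
  rewrite /root map_Poly_id0 //= !horner_cons hornerC mul0r add0r.
  have -> : (((1%:~R * (4 * x0) + b2%:~R) * (4 * x0) + (8 * b4)%:~R) * (4 * x0) + (16 * b6)%:~R)
    = 16 * (4 * x0 ^+ 3 + b2%:~R * x0 ^+ 2 + 2 * b4%:~R * x0 + b6%:~R) :> rat by ring.
  by rewrite T mulr0.
have DD : (4 * (x0 - x1)) ^+ 2 = (3 * X0 ^+ 2 + 2 * b2 * X0 + 8 * b4)%:~R.
  have -> : (4 * (x0 - x1)) ^+ 2 = 8 * (2 * (x0 - x1) ^+ 2) by ring.
  rewrite H !(rmorphD, rmorphM, rmorphXn) /= -DX; ring.
have [D DD'] : exists n : int, 4 * (x0 - x1) = n%:~R.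
  apply: (@rational_root_monic_int (Poly [:: - (3 * X0 ^+ 2 + 2 * b2 * X0 + 8 * b4); 0; 1])).
    by rewrite monicE lead_coefE (PolyK (c := 0)).
  rewrite /root map_Poly_id0 //= !horner_cons hornerC mul0r add0r mulr0z addr0 mul1r -expr2.
  by rewrite DD rmorphN /= subrr.
exists X0, D; split; apply: (intr_inj (R := rat)).
  have -> : (X0 ^+ 3 + b2 * X0 ^+ 2 + 8 * b4 * X0 + 16 * b6)%:~R =
     16 * (4 * x0 ^+ 3 + b2%:~R * x0 ^+ 2 + 2 * b4%:~R * x0 + b6%:~R) :> rat.
    by rewrite !(rmorphD, rmorphM, rmorphXn) /= -DX; ring.
  by rewrite T mulr0.
by rewrite rmorphXn /= -DD'.
Qed.

(** With U = 4 x - X0 and V = 4 (2 y + a1 x + a3) the curve becomes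
    V ^ 2 = U (U ^ 2 + A U + D ^ 2), where A = 3 X0 + b2. *)
Lemma card_affine_mod4 (F : finFieldType) (W : weierstrass F) (X0 D : F) :
  2 != 0 :> F -> wdisc W != 0 ->
  X0 ^+ 3 + wb2 W * X0 ^+ 2 + 8 * wb4 W * X0 + 16 * wb6 W = 0 ->
  D ^+ 2 = 3 * X0 ^+ 2 + 2 * wb2 W * X0 + 8 * wb4 W ->
  (#|[set u : F * F | on_affine W u.1 u.2]%SET| = 3 %[mod 4])%N.
Proof.
move=> two0 disc0 T H.
have pow2 k : 2 ^+ k != 0 :> F by rewrite expf_neq0.
have four0 : 4 != 0 :> F by rewrite (_ : 4 = 2 ^+ 2) //; ring.
have eight0 : 8 != 0 :> F by rewrite (_ : 8 = 2 ^+ 3) //; ring.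
have sixteen0 : 16 != 0 :> F by rewrite (_ : 16 = 2 ^+ 4) //; ring.
pose A := 3 * X0 + wb2 W.
(* The discriminant of the new model, up to the factor 16; it shows that the
   new model is smooth too. *)
have discE : D ^+ 4 * (A ^+ 2 - 4 * D ^+ 2) = 2 ^+ 8 * wdisc W.
  have E4 : wb4 W = (D ^+ 2 - 3 * X0 ^+ 2 - 2 * wb2 W * X0) / 8 by rewrite H; field.
  have E6 : wb6 W = - (X0 ^+ 3 + wb2 W * X0 ^+ 2 + 8 * wb4 W * X0) / 16.
    by rewrite -[X in - X](addrK (16 * wb6 W)) T; field.
  have E8 : wb8 W = (wb2 W * wb6 W - wb4 W ^+ 2) / 4 by rewrite /wb2 /wb4 /wb6 /wb8; field.
  rewrite /wdisc /A E8 E6 E4; field.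
  by rewrite ?four0 ?eight0 ?sixteen0.
have [D0 AD0] : D != 0 /\ A ^+ 2 - 4 * D ^+ 2 != 0.
  have := mulf_neq0 (pow2 8%N) disc0; rewrite -discE mulf_eq0 negb_or => /andP[D4 ->].
  by split=> //; apply: contraNneq D4 => ->; rewrite expr0n.
rewrite -(card_halvable_origin_mod4 two0 D0 AD0).
pose f (w : F * F) := (4 * w.1 - X0, 4 * (2 * w.2 + wa1 W * w.1 + wa3 W)).
have f_inj : injective f.
  move=> [x y] [x' y'] [] /addIr /(mulfI four0) <- /(mulfI four0) /addIr /addIr.
  by move=> /(mulfI two0) <-.
rewrite -(card_imset _ f_inj); congr (#|pred_of_set _| %% 4)%N.
have f_onto w : f ((w.1 + X0) / 4, (w.2 / 4 - wa1 W * ((w.1 + X0) / 4) - wa3 W) / 2) = w.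
  case: w => U V; rewrite /f /=; congr (_, _); field; rewrite ?four0 ?two0 //.
have fP w : ((f w).2 ^+ 2 == (f w).1 * ((f w).1 ^+ 2 + A * (f w).1 + D ^+ 2)) =
    on_affine W w.1 w.2.
  rewrite /on_affine -[LHS]subr_eq0 -[RHS]subr_eq0 -[RHS](mulrI_eq0 _ (lregP (pow2 6%N))).
  congr (_ == _); rewrite H /f /A /=.
  rewrite -[RHS]addr0 -[X in _ = _ + X]T /wb2 /wb4 /wb6; ring.
apply/setP => w; rewrite [in RHS]inE -[w in RHS]f_onto fP.
apply/imsetP/idP => [[w' on_w' ->]|on_w].
  by rewrite inE -fP -fP f_onto fP in on_w' *.
by exists ((w.1 + X0) / 4, (w.2 / 4 - wa1 W * ((w.1 + X0) / 4) - wa3 W) / 2);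
  rewrite ?inE ?f_onto.
Qed.

(** The change of variables x = u ^ 2 x' + r carries the two abscissae given by
    the isogeny to the integral model W, where they are reduced modulo p.  The
    3 mod 4 affine points leave p - 3 = 2 mod 4 for the trace. *)
Lemma frobenius_trace_four_isogeny (E : weierstrass rat) (W : weierstrass int) p :
  has_cyclic_rational_4_isogeny E -> integral_model E W ->
  prime p -> p = 1 %[mod 4]%N -> good_reduction p W ->
  exists c : int, frobenius_trace p W = 2 + 4 * c.
Proof.
move=> isogE [u [r [s [t [u0 iso]]]]] pr_p p1 goodW.
have [x0 [x1 [T H]]] := four_isogeny_rational_halving isogE.
have T' : two_division_poly (wmap intr W) ((x0 - r) / u ^+ 2) = 0.
  apply: (mulfI (expf_neq0 6%N u0)); rewrite mulr0 -[RHS]T.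
  exact: two_division_poly_change u0 iso _.
have H' : 2 * ((x0 - r) / u ^+ 2 - (x1 - r) / u ^+ 2) ^+ 2 =
    halving_poly (wmap intr W) ((x0 - r) / u ^+ 2).
  apply: subr0_eq; apply: (mulfI (expf_neq0 4%N u0)).
  by rewrite (halving_poly_change u0 iso) H subrr mulr0.
have [X0 [D [TZ HZ]]] := integral_halving T' H'.
have two0 : 2 != 0 :> 'F_p.
  rewrite -(dvdn_pcharf (pchar_Fp pr_p)) gtnNdvd //.
  by have := prime_gt1 pr_p; case: (p) p1 => [|[|[|q]]].
have card3 : (#|[set u : 'F_p * 'F_p | on_affine (reduction p W) u.1 u.2]%SET| = 3 %[mod 4])%N.
  have wb2E : wb2 (reduction p W) = (wb2 W)%:~R by rewrite /wb2 /=; ring.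
  have wb4E : wb4 (reduction p W) = (wb4 W)%:~R by rewrite /wb4 /=; ring.
  have wb6E : wb6 (reduction p W) = (wb6 W)%:~R by rewrite /wb6 /=; ring.
  apply: (card_affine_mod4 (X0 := X0%:~R) (D := D%:~R) two0 goodW).
    rewrite wb2E wb4E wb6E; transitivity
      ((X0 ^+ 3 + wb2 W * X0 ^+ 2 + 8 * wb4 W * X0 + 16 * wb6 W)%:~R : 'F_p); first by ring.
    by rewrite TZ.
  by rewrite wb2E wb4E -rmorphXn /= HZ; ring.
rewrite /frobenius_trace; move: #|_| card3 => n n3.
exists (((p%:Z - n%:Z) - 2) %/ 4)%Z; lia.
Qed.

(** * Divisibility by powers of a prime above 2 *)

Section IdealArithmetic.
Variable K : fieldExtType rat.
Implicit Types (I J P : set K) (x y : K).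
Local Open Scope classical_set_scope.

Lemma integers_ideal : ideal (@integers K).
Proof.
split=> //; first exact: mxpoly.integral0.
  by move=> x y; apply: integral_add.
by move=> x y; apply: integral_mul.
Qed.

Lemma integers_int (z : int) : @integers K z%:~R.
Proof. exact: integral_id. Qed.

Lemma ideal_sum I (T : eqType) (s : seq T) (f : T -> K) :
  ideal I -> (forall u, u \in s -> I (f u)) -> I (\sum_(u <- s) f u).
Proof.
case=> _ I0 IA _; elim: s => [|u s IHs] Is; first by rewrite big_nil.
rewrite big_cons; apply: IA; first by apply: Is; rewrite mem_head.
by apply: IHs => v vs; apply: Is; rewrite inE vs orbT.
Qed.

Lemma ideal_opp I x : ideal I -> I x -> I (- x).
Proof.
case=> _ _ _ IM Ix; rewrite -mulN1r; apply: IM => //.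
exact: (integers_int (-1)).
Qed.

Lemma ideal_mul_mem I J x y : I x -> J y -> ideal_mul I J (x * y).
Proof.
move=> Ix Jy; exists [:: (x, y)]; last by rewrite big_seq1.
by move=> u; rewrite inE => /eqP->.
Qed.

Lemma ideal_mulP I J L : ideal L ->
  (forall x y, I x -> J y -> L (x * y)) -> ideal_mul I J `<=` L.
Proof.
move=> idL IJL _ [s sIJ ->]; apply: ideal_sum => // u /sIJ[]; exact: IJL.
Qed.

Lemma ideal_mul_ideal I J : ideal I -> ideal J -> ideal (ideal_mul I J).
Proof.
move=> idI idJ; have [IZ _ _ IM] := idI; have [JZ _ _ _] := idJ; split.
- apply: ideal_mulP; first exact: integers_ideal.
  by move=> x y /IZ ? /JZ ?; apply: integral_mul.
- by exists [::]; rewrite ?big_nil.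
- move=> _ _ [s sIJ ->] [r rIJ ->]; exists (s ++ r); last by rewrite big_cat.
  by move=> u; rewrite mem_cat => /orP[/sIJ|/rIJ].
move=> x _ Zx [s sIJ ->]; exists [seq (x * u.1, u.2) | u <- s].
  by move=> _ /mapP[u /sIJ[Iu Ju] ->]; split=> //; apply: IM.
by rewrite big_map mulr_sumr; apply: eq_bigr => u _; rewrite mulrA.
Qed.

Lemma ideal_exp_ideal I n : ideal I -> ideal (ideal_exp I n).
Proof.
by move=> idI; elim: n => [|n IHn]; [exact: integers_ideal | exact: ideal_mul_ideal].
Qed.

Lemma ideal_exp_anti I m n : ideal I -> (m <= n)%N ->
  ideal_exp I n `<=` ideal_exp I m.
Proof.
move=> idI /subnK <-; elim: (n - m)%N => [//|k IHk] x Ix.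
apply: IHk; move: x Ix; apply: ideal_mulP; first exact: ideal_exp_ideal.
by have [_ _ _ h] := ideal_exp_ideal (k + m) idI; have [IZ _ _ _] := idI;
  move=> x y /IZ; apply: h.
Qed.

(** Suppose that p belongs to P ^ (e + 1), and let (p) = P ^ e J.  Multiplying
    by J gives p J in P (P ^ e J) = p P, hence J in P, against the choice of J.
    The equality (p) = P ^ e J replaces the invertibility of P. *)
Lemma prime_exp_ramification (p : nat) P e :
  prime p -> prime_over p P -> ramification_index p P e -> ~ ideal_exp P e.+1 p%:R.
Proof.
move=> pr_p [[idP _ _] _] [J [idJ JP DpJ]] pPe; apply: JP => x Jx.
have p0 : p%:R != 0 :> K.
  by rewrite -(rmorph_nat (in_alg K)) fmorph_eq0 pnatr_eq0 -lt0n prime_gt0.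
pose L : set K := [set z | integers z /\ P (z / p%:R)].
have idL : ideal L.
  have [PZ P0 PA PM] := idP; split; first by move=> z [].
  - by split; [exact: mxpoly.integral0 | rewrite /= mul0r].
  - move=> y z [Zy Py] [Zz Pz]; split; first exact: integral_add.
    by rewrite /= mulrDl; apply: PA.
  - move=> y z Zy [Zz Pz]; split; first exact: integral_mul.
    by rewrite /= -mulrA; apply: PM.
suff : L (p%:R * x) by case; rewrite mulrAC mulfV ?mul1r.
have {pPe} [s sP Ds] := pPe; rewrite [X in X * x]Ds mulr_suml.
apply: ideal_sum => // u /sP[Pu1 Pu2].
have [JZ _ _ _] := idJ; have [PZ _ _ PM] := idP.
have [eZ _ _ _] := ideal_exp_ideal e idP.
split.
  by apply: integral_mul; [apply: integral_mul; [exact: PZ | exact: eZ] | exact: JZ].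
(* u.1 is in P, and u.2 * x in P ^ e J is a multiple p * y of p. *)
have [y Zy Dy] : principal p%:R (u.2 * x) by rewrite DpJ; apply: ideal_mul_mem.
by rewrite -(mulrA u.1) -Dy mulrCA (mulrC p%:R) mulfK // mulrC; apply: PM.
Qed.

(** The multiple 4 c of 4 = 2 * 2 belongs to P * P ^ e, so 2 + 4 c in P ^ m
    would put 2 in P ^ (e + 1). *)
Lemma twice_odd_notin_ideal_exp P e m (c : int) :
  prime_over 2 P -> ramification_index 2 P e -> (0 < e < m)%N ->
  ~ ideal_exp P m (2 + 4 * c)%:~R.
Proof.
move=> ovP ramP /andP[e0 em] Pm; have [[idP _ _] P2] := ovP.
have [_ _ eA eM] := ideal_exp_ideal e.+1 idP.
apply: (prime_exp_ramification (isT : prime 2) ovP ramP).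
have -> : 2%:R = (2 + 4 * c)%:~R + - (c%:~R * (2%:R * 2%:R)) :> K by ring.
apply: eA; first exact: ideal_exp_anti em _ _.
apply: ideal_opp; first exact: ideal_exp_ideal.
apply: eM; first exact: integers_int.
apply: ideal_mul_mem => //.
have [J [idJ _ D2]] := ramP.
have : principal 2%:R (2%:R : K) by exists 1; [exact: mxpoly.integral1 | rewrite mulr1].
rewrite D2; apply: ideal_mulP; first exact: ideal_exp_ideal.
have [_ _ _ M] := ideal_exp_ideal e idP; have [JZ _ _ _] := idJ.
by move=> x y Px /JZ Zy; rewrite mulrC; apply: M.
Qed.

(** The closeness condition in the form that is used.  The case e = 0 is
    excluded because the quotient is then 0. *)
Lemma alpha_ge1 (m e : nat) :
  1 <= alpha (Num.ceil (m%:R / e%:R : rat)) -> (0 < e < m)%N.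
Proof.
rewrite /alpha; case: ifP => // /negbT; rewrite -ltNge => lt1 _; case: e lt1 => [|e].
  by rewrite invr0 mulr0 ceil0.
by rewrite ceil_gt_int ltr_pdivlMr ?ltr0Sn // mul1r ltr_nat.
Qed.

End IdealArithmetic.

(** * Hecke relations *)

Section HeckeEigenvalues.
Variable R : realType.
Variables (w N : nat) (c : nat -> complex R).
Hypothesis c1 : c 1%N = 1.
Hypothesis eigen : forall m, (0 < m)%N ->
  exists lambda, forall n, hecke w N m c n = lambda * c n.

Lemma divisors_prime p : prime p -> divisors p = [:: 1; p]%N.
Proof.
move=> pr_p; apply: (irr_sorted_eq ltn_trans ltnn).
- exact: sorted_divisors_ltn.
- by rewrite /= prime_gt1.
move=> d; rewrite -dvdn_divisors ?prime_gt0 // !inE.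
by have /primeP[_ h] := pr_p; apply/idP/idP => [/h //|/orP[]/eqP->].
Qed.

Lemma hecke_eigenvalue m n : (0 < m)%N -> hecke w N m c n = c m * c n.
Proof.
move=> m0; have [l Dl] := eigen m0; rewrite Dl; congr (_ * _).
have := Dl 1%N; rewrite c1 mulr1 => <-.
by rewrite /hecke gcdn1 big_cons big_nil coprime1n expr1n mul1r addr0 muln1 exp1n divn1.
Qed.

Lemma coefficient_coprime_mul m n : (0 < m)%N -> coprime m n ->
  c (m * n)%N = c m * c n.
Proof.
move=> m0 /eqP co_mn; rewrite -hecke_eigenvalue // /hecke co_mn.
by rewrite big_cons big_nil coprime1n expr1n mul1r addr0 exp1n divn1.
Qed.

Lemma coefficient_prime_power p r : prime p -> ~~ (p %| N)%N ->
  c p * c (p ^ r.+1)%N = c (p ^ r.+2)%N + p%:R ^+ w.-1 * c (p ^ r)%N.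
Proof.
move=> pr_p pN; have p0 := prime_gt0 pr_p.
rewrite -hecke_eigenvalue // /hecke.
rewrite (gcdn_idPl _) ?dvdn_exp // divisors_prime //.
rewrite !big_cons big_nil coprime1n prime_coprime // pN.
rewrite expr1n mul1r addr0 exp1n divn1 -expnS; congr (_ + _ * c _).
by rewrite -[in RHS](mulnK (p ^ r) (_ : 0 < p ^ 2)%N) ?expn_gt0 ?p0 // -expnD addn2.
Qed.

(** When c p = 0 the recursion reads c (p ^ (r + 2)) = - p ^ (w - 1) c (p ^ r). *)
Lemma coefficient_prime_even_power p r : prime p -> ~~ (p %| N)%N ->
  c p = 0 -> c (p ^ r.*2)%N != 0.
Proof.
move=> pr_p pN cp; elim: r => [|r IHr]; first by rewrite c1 oner_neq0.
have /eqP := coefficient_prime_power r.*2 pr_p pN.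
rewrite cp mul0r eq_sym addr_eq0 doubleS => /eqP->.
by rewrite oppr_eq0 mulf_neq0 // expf_neq0 // pnatr_eq0 -lt0n prime_gt0.
Qed.

Lemma coefficient_neq0 n : (0 < n)%N ->
  (forall p, prime p -> (p %| n)%N -> c (p ^ logn p n)%N != 0) -> c n != 0.
Proof.
have [k] := ubnP n; elim: k n => // k IHk n ltnk n0 cn.
have [->|n1] := eqVneq n 1%N; first by rewrite c1 oner_neq0.
have n_gt1 : (1 < n)%N by rewrite ltn_neqAle eq_sym n1.
set p := pdiv n; have pr_p : prime p := pdiv_prime n_gt1.
have pn : (p %| n)%N := pdiv_dvd n.
have Dn : n = (n`_p * n`_p^')%N by rewrite partnC.
rewrite {1}Dn coefficient_coprime_mul ?part_gt0 ?coprime_partC //.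
rewrite mulf_neq0 //; first by rewrite p_part cn.
apply: IHk; rewrite ?part_gt0 //.
  apply: leq_trans (_ : n <= k)%N; last by rewrite -ltnS.
  rewrite [X in (_ < X)%N]Dn ltn_Pmull ?part_gt0 // p_part.
  by rewrite -{1}(expn0 p) ltn_exp2l ?prime_gt1 // logn_gt0 mem_primes pr_p n0 pn.
move=> q pr_q qn; have : q \in p^'.
  by apply: pnatP _ _ _ q pr_q qn; rewrite ?part_gt0 ?part_pnat.
move=> p'q; have -> : logn q n`_p^' = logn q n.
  rewrite [in RHS]Dn lognM ?part_gt0 // p_part lognX (logn_prime q pr_p).
  by rewrite (negPf (p'q : q != p)) muln0.
by apply: cn => //; apply: dvdn_trans qn _; apply: dvdn_part.
Qed.

End HeckeEigenvalues.

(** * Sums of two squares in short intervals *)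

(** Otherwise u ^ 2 = - v ^ 2 with u and v nonzero modulo p; raising this to the
    odd power (p - 1) / 2 and applying Fermat's little theorem gives 1 = - 1. *)
Lemma dvdn_sum_two_squares p u v : prime p -> p = 3 %[mod 4]%N ->
  (p %| u ^ 2 + v ^ 2)%N -> (p %| u)%N && (p %| v)%N.
Proof.
move=> pr_p p3; have Dp : p = (4 * (p %/ 4) + 3)%N by lia.
set h := (2 * (p %/ 4) + 1)%N; have Dh : p.-1 = (2 * h)%N by lia.
have p0 (x : nat) : (x%:R == 0 :> 'F_p) = (p %| x)%N.
  by rewrite -(dvdn_pcharf (pchar_Fp pr_p)).
rewrite -!p0 natrD !natrX => uv0.
have fermat (x : 'F_p) : x != 0 -> x ^+ (2 * h) = 1.
  move=> x0; apply: (mulfI x0); rewrite -Dh -exprS prednK ?prime_gt0 // mulr1.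
  by rewrite -[X in _ ^+ X](card_Fp pr_p) expf_card.
suff v0 : v%:R == 0 :> 'F_p by move: uv0; rewrite (eqP v0) expr0n addr0 expf_eq0 eqxx andbT.
apply: contraT => v0.
have Du : u%:R ^+ 2 = - v%:R ^+ 2 :> 'F_p by apply/eqP; rewrite -addr_eq0.
have u0 : u%:R != 0 :> 'F_p.
  by have := expf_neq0 2 v0; rewrite -oppr_eq0 -Du expf_eq0.
have := fermat _ u0; rewrite exprM Du exprNn -exprM fermat // mulr1.
have -> : h = (p %/ 4).*2.+1 by lia.
rewrite exprS -mul2n exprM sqrrN expr1n expr1n mulr1 => /eqP.
rewrite eq_sym -subr_eq0 opprK (_ : 1 + 1 = 2%:R) // p0.
by move=> /dvdn_leq - /(_ isT); lia.
Qed.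

Lemma even_logn_sum_two_squares p u v : prime p -> p = 3 %[mod 4]%N ->
  (0 < u ^ 2 + v ^ 2)%N -> ~~ odd (logn p (u ^ 2 + v ^ 2)).
Proof.
move=> pr_p p3; have [k] := ubnP (u ^ 2 + v ^ 2)%N.
elim: k u v => // k IHk u v ltk uv0.
have [pn|pn] := boolP (p %| u ^ 2 + v ^ 2)%N; last by rewrite lognE (negPf pn) !andbF.
have /andP[/dvdnP[u' Du] /dvdnP[v' Dv]] := dvdn_sum_two_squares pr_p p3 pn.
have Duv : (u ^ 2 + v ^ 2 = (u' ^ 2 + v' ^ 2) * p ^ 2)%N by rewrite Du Dv !expnMn mulnDl.
have uv'0 : (0 < u' ^ 2 + v' ^ 2)%N by move: uv0; rewrite Duv muln_gt0 => /andP[].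
have p2 : (0 < p ^ 2)%N by rewrite expn_gt0 prime_gt0.
rewrite Duv lognM // pfactorK // oddD addbF.
apply: IHk => //; rewrite ltnS in ltk; apply: leq_trans ltk; rewrite Duv.
by rewrite ltn_Pmulr // -{1}(expn0 p) ltn_exp2l // prime_gt1.
Qed.

(** Greedy choice of s, then of t.  The remainder r = n - (q s + 1) ^ 2 is at
    most q (2 m + q), where m = q s + 1 is at most the square root of n; and
    with t + 1 minimal, (q t) ^ 2 < r bounds t by a constant times the fourth
    root of n, while the overshoot is less than q ^ 2 (2 t + 1). *)
Lemma sum_two_squares_short_interval (q n : nat) : (0 < q)%N -> (0 < n)%N ->
  exists j s t : nat, [/\ (n + j = (q * s + 1) ^ 2 + (q * t) ^ 2)%N &
     (j ^ 4 <= (6 * q ^ 2) ^ 4 * n)%N].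
Proof.
move=> q0 n0.
have exs : exists s, ((q * s + 1) ^ 2 <= n)%N by exists 0%N; rewrite muln0.
have bds s : ((q * s + 1) ^ 2 <= n -> s <= n)%N.
  apply: leq_trans; rewrite expnS expn1; apply: leq_trans (leq_pmulr _ _); rewrite addn1 //.
  by rewrite leqW // leq_pmull.
case: (ex_maxnP exs bds) => s les maxs.
have lts : (n < (q * s.+1 + 1) ^ 2)%N.
  by rewrite ltnNge; apply/negP => /maxs; rewrite ltnn.
set m := (q * s + 1)%N in les; set r := (n - m ^ 2)%N.
have m0 : (0 < m)%N by rewrite /m addn1.
have ler : (r <= q * (2 * m + q))%N.
  have : (n < (m + q) ^ 2)%N by move: lts; rewrite /m mulnS -addnA addnC.
  by rewrite sqrnD /r -mulnn; lia.
have ext : exists t, (r <= (q * t) ^ 2)%N.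
  exists r; rewrite expnMn; apply: leq_trans (leq_pmull _ _); rewrite ?expn_gt0 ?q0 //.
  by case: (r) => // r'; rewrite expnS expn1 leq_pmulr.
case: (ex_minnP ext) => t let_ mint.
exists ((q * t) ^ 2 - r)%N, s, t; split; first by rewrite -/m /r; lia.
(* t = 0 is the case where n is itself (q s + 1) ^ 2. *)
case: t let_ mint => [|t] let_ mint; first by rewrite muln0 sub0n exp0n.
have ltt : ((q * t) ^ 2 < r)%N.
  by rewrite ltnNge; apply/negP => /mint; rewrite ltnn.
have tm : (t ^ 2 < 3 * m)%N.
  rewrite -(ltn_pmul2l (_ : 0 < q ^ 2)%N) ?expn_gt0 ?q0 // -expnMn.
  apply: leq_trans ltt (leq_trans ler _).
  have -> : (q ^ 2 * (3 * m) = q * (2 * (q * m) + q * m))%N by ring.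
  by rewrite leq_mul2l leq_add ?orbT ?leq_pmulr // leq_mul2l leq_pmull ?orbT.
have t4 : (t ^ 4 <= 9 * n)%N.
  apply: leq_trans (_ : 9 * m ^ 2 <= _)%N; last by rewrite leq_mul2l les.
  by rewrite (expnM t 2 2) -(expnMn 3 m 2) leq_exp2r // ltnW.
have lej : ((q * t.+1) ^ 2 - r <= q ^ 2 * (2 * t + 1))%N.
  rewrite leq_subLR; apply: leq_trans (_ : (q * t) ^ 2 + q ^ 2 * (2 * t + 1) <= _)%N.
    by apply: eq_leq; ring.
  by rewrite leq_add2r ltnW.
apply: leq_trans (_ : (q ^ 2 * (2 * t + 1)) ^ 4 <= _)%N; first by rewrite leq_exp2r.
rewrite expnMn [(6 * _)%N]mulnC expnMn -mulnA leq_mul2l; apply/orP; right.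
(* It remains to bound (2 t + 1) ^ 4 by 6 ^ 4 * n; for t > 0 it is at most
   (3 t) ^ 4 <= 81 * 9 * n. *)
have [->|t0] := posnP t; first by rewrite muln0 add0n exp1n muln_gt0 n0.
apply: leq_trans (_ : (3 * t) ^ 4 <= _)%N; first by rewrite leq_exp2r //; lia.
rewrite expnMn; apply: leq_trans (_ : 3 ^ 4 * (9 * n) <= _)%N.
  by rewrite leq_mul2l t4 orbT.
by rewrite mulnA leq_mul2r; apply/orP; right.
Qed.

(** * Nonvanishing coefficients *)

Lemma odd_mod4 n : odd n -> n = 1 %[mod 4]%N \/ n = 3 %[mod 4]%N.
Proof. lia. Qed.

Section CoefficientNonvanishing.
Variables (R : realType) (K : fieldExtType rat) (iota : {rmorphism K -> complex R}).
Variables (k N M : nat) (f : complex R -> complex R) (a : nat -> K).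
Variables (E : weierstrass rat) (NE : nat) (fE : complex R -> complex R) (b : nat -> int).
Hypothesis eigen_f : normalized_cuspidal_eigenform (2 * k) N f (fun n => iota (a n)).
Hypothesis isogE : has_cyclic_rational_4_isogeny E.
Hypothesis corrE : corresponds_to_curve E NE fE b.
Hypothesis close : two_adically_close k N a 1 NE (fun n => (b n)%:~R).
Hypothesis vanishM : forall p, prime p -> ~~ (p %| M)%N ->
  a p = 0 \/ (forall r, (1 <= r)%N -> a (p ^ r)%N != 0).

(** A prime not dividing the conductor is a prime of good reduction: the
    conductor exponent is at least 1 otherwise. *)
Lemma curve_coefficient_mod4 p : prime p -> ~~ (p %| NE)%N -> p = 1 %[mod 4]%N ->
  exists c : int, b p = 2 + 4 * c.
Proof.
move=> pr_p pNE p1; have [[_ condE] _ tr] := corrE.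
have := condE p pr_p; rewrite lognE (negPf pNE) !andbF => -[W [minW _ multW addW]].
rewrite (tr p W pr_p minW).
apply: (frobenius_trace_four_isogeny isogE minW.1 pr_p p1).
rewrite /good_reduction; apply/negP => sing.
have [c4|c4] := boolP (wc4 (reduction p W) == 0).
  by have [|delta _] := addW; first by apply/andP.
by have := multW; rewrite /multiplicative_reduction sing c4 => /(_ isT).
Qed.

(** If a p = 0, closeness puts b p = 2 mod 4 in the power of q above. *)
Lemma coefficient_prime_1mod4_neq0 p : prime p -> ~~ (p %| 2 * N * NE)%N ->
  p = 1 %[mod 4]%N -> a p != 0.
Proof.
move=> pr_p pB p1; apply/eqP => ap0.
have pNE : ~~ (p %| NE)%N by apply: contra pB; apply: dvdn_mull.
have [c Dc] := curve_coefficient_mod4 pr_p pNE p1.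
have [s [_ _ [P [e [m [ovP ramP al1 _ cong_ab]]]]]] := close.
have := cong_ab p pr_p pB; rewrite ap0 sub0r Dc => Pb.
have [idP _ _] := ovP.1.
apply: (twice_odd_notin_ideal_exp (c := c) ovP ramP (alpha_ge1 al1)).
by rewrite -[X in ideal_exp _ _ X]opprK; apply: ideal_opp => //; apply: ideal_exp_ideal.
Qed.

(** At a prime p = 3 mod 4 with a p = 0 the exponent of p in n is even, and only
    the odd powers of p have a vanishing coefficient; at p = 1 mod 4 the
    coefficient a p is not zero in the first place. *)
Lemma coefficient_sum_two_squares_neq0 n u v :
  (0 < n)%N -> n = (u ^ 2 + v ^ 2)%N -> coprime n (2 * (lcmn N M * NE)) ->
  a n != 0.
Proof.
move=> n0 Dn co_n; rewrite -(fmorph_eq0 iota).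
have [[_ _ _ eig] c1] := eigen_f.
apply: (coefficient_neq0 c1 eig n0) => p pr_p pn; rewrite fmorph_eq0.
have pB : ~~ (p %| 2 * (lcmn N M * NE))%N.
  by apply/negP => pB; have := coprime_dvdl pn co_n; rewrite prime_coprime // pB.
have pM : ~~ (p %| M)%N.
  apply: contra pB => pM; apply/dvdn_mull/dvdn_mulr.
  exact: dvdn_trans pM (dvdn_lcmr _ _).
have pN : ~~ (p %| N)%N.
  apply: contra pB => pN; apply/dvdn_mull/dvdn_mulr.
  exact: dvdn_trans pN (dvdn_lcml _ _).
have pNE : ~~ (p %| NE)%N by apply: contra pB => pNE; do 2!apply: dvdn_mull.
have p2 : ~~ (p %| 2)%N by apply: contra pB; apply: dvdn_mulr.
have logn0 : (0 < logn p n)%N by rewrite logn_gt0 mem_primes pr_p n0.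
have [ap0|->//] := vanishM pr_p pM.
have p_odd : odd p by case: (even_prime pr_p) p2 => // ->.
have [p1|p3] := odd_mod4 p_odd.
  suff: a p != 0 by rewrite ap0 eqxx.
  by apply: coefficient_prime_1mod4_neq0; rewrite // !Euclid_dvdM // !negb_or p2 pN.
have ev : ~~ odd (logn p n) by rewrite Dn even_logn_sum_two_squares // -Dn.
rewrite -(fmorph_eq0 iota) -(even_halfK ev).
by apply: (coefficient_prime_even_power c1 eig); rewrite // ap0 rmorph0.
Qed.

End CoefficientNonvanishing.

Lemma gap_index_le (V : nmodType) (a : nat -> V) n j :
  a (n + j)%N != 0 -> exists2 i, gap_index a n i & (i <= j)%N.
Proof.
move=> aj; rewrite /gap_index; have [an|an] := eqVneq (a n) 0; last by exists 0%N.
have ex : exists j, a (n + j)%N != 0 by exists j.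
case: (ex_minnP ex) => m am min_m.
have m0 : (0 < m)%N by case: m am {min_m} => //; rewrite addn0 an eqxx.
exists m.-1; last by apply: leq_trans (min_m j aj); apply: leq_pred.
split=> [i lei|i zi].
  by apply: contraTeq lei => /min_m; rewrite -ltnNge; case: (m) m0.
rewrite leqNgt; apply/negP => ltmi; case/eqP: am.
by apply: zi; case: (m) ltmi.
Qed.

Lemma le_fourth_root (R : realType) (i c n : nat) :
  (i ^ 4 <= c ^ 4 * n)%N -> i%:R <= c%:R * n%:R `^ 4^-1 :> R.
Proof.
move=> le4; rewrite -(ler_pXn2r (n := 4)) ?nnegrE ?mulr_ge0 ?powR_ge0 //.
rewrite exprMn -[X in _ * X]powR_mulrn ?powR_ge0 // -powRrM mulVf ?pnatr_eq0 // powRr1 //.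
by rewrite -!natrX -natrM ler_nat.
Qed.

Theorem theorem5p3 (R : realType) (B : nat) :
  exists2 C : R, 0 < C &
  forall (K : fieldExtType rat) (iota : {rmorphism K -> complex R})
         (k N M : nat) (f : complex R -> complex R) (a : nat -> K)
         (E : weierstrass rat) (NE : nat)
         (fE : complex R -> complex R) (b : nat -> int),
    (1 < k)%N -> (1 < N)%N ->
    normalized_cuspidal_eigenform (2 * k) N f (fun n => iota (a n)) ->
    (forall n, integers (a n)) ->
    (1 <= M)%N ->
    (forall p, prime p -> ~~ (p %| M)%N ->
       a p = 0 \/ (forall r, (1 <= r)%N -> a (p ^ r)%N != 0)) ->
    elliptic_curve E ->
    has_cyclic_rational_4_isogeny E ->
    corresponds_to_curve E NE fE b ->
    two_adically_close k N a 1 NE (fun n => (b n)%:~R) ->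
    (lcmn N M * NE)%N = B ->
    exists n0 : nat, forall n : nat, (n0 <= n)%N ->
      exists2 i : nat, gap_index a n i & i%:R <= C * n%:R `^ 4^-1.
Proof.
(* Adding 1 keeps the constant positive for B = 0, a value never attained. *)
pose c := (6 * (2 * B) ^ 2)%N.
exists (c%:R + 1) => [|K iota k N M f a E NE fE b _ N1 eig _ M1 vanishM _ isogE corrE close DB].
  by rewrite ltr_wpDl.
have B0 : (0 < B)%N.
  have [[NE0 _] _ _] := corrE.
  by rewrite -DB muln_gt0 NE0 lcmn_gt0 M1 (ltnW N1).
exists 1%N => n n0.
have q0 : (0 < 2 * B)%N by rewrite muln_gt0.
have [j [s [t [Dnj lej]]]] := sum_two_squares_short_interval q0 n0.
have co : coprime (n + j) (2 * (lcmn N M * NE)).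
  rewrite DB Dnj /coprime -gcdn_modl.
  have -> : ((2 * B * s + 1) ^ 2 + (2 * B * t) ^ 2 =
    (2 * B * s ^ 2 + 2 * s + 2 * B * t ^ 2) * (2 * B) + 1)%N by ring.
  by rewrite modnMDl gcdn_modl gcd1n.
have anj : a (n + j)%N != 0.
  apply: (coefficient_sum_two_squares_neq0 eig isogE corrE close vanishM _ Dnj co).
  by rewrite Dnj addn_gt0 expn_gt0 addn1.
have [i gapi leij] := gap_index_le anj.
exists i => //; apply: le_trans (_ : j%:R <= _); first by rewrite ler_nat.
apply: le_trans (le_fourth_root _ lej) _.
by rewrite ler_wpM2r ?powR_ge0 // lerDl.
Qed.
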